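(* Suppose $\phi''(2F)\le 0$. Then $y_F$ is stable in the atomistic model (i.e. $y_F$ is a stable equilibrium of $\mathcal{E}_{\rm a}$) if and only if $$A_F-\varepsilon^2\mu_\varepsilon^2\,\phi''(2F)>0,\qquad\text{where } A_F=\phi''(F)+4\phi''(2F),\quad \mu_\varepsilon=\frac{2\sin(\pi\varepsilon/2)}{\varepsilon}.$$
   Context: Fix $N\in\mathbb{N}$ and set $\varepsilon=1/N$. The interaction potential $\phi$ satisfies: (i) $\phi\in C^4((0,\infty);\mathbb{R})$; (ii) there is $r_*>0$ such that $\phi$ is convex in $(0,r_* )$ and concave in $(r_*,\infty)$; (iii) $\phi^{(k)}(r)\to0$ rapidly as $r\to\infty$ for $k=0,\dots,4$. Throughout, $F>0$ with $F\ge r_*/2$. For a sequence $v=(v_\ell)_{\ell\in\mathbb{Z}}$ write $v_\ell'=\varepsilon^{-1}(v_\ell-v_{\ell-1})$. Let $\mathcal{U}$ be the space of real sequences $u=(u_\ell)_{\ell\in\mathbb{Z}}$ with $u_{\ell+2N}=u_\ell$ for all $\ell$ and $\sum_{\ell=-N+1}^N u_\ell=0$. Let $y_F=(F\ell\varepsilon)_{\ell\in\mathbb{Z}}$ and $\mathcal{Y}_F=\{y_F+u:u\in\mathcal{U}\}$. The atomistic energy per period of $y\in\mathcal{Y}_F$ (finite when all $y_\ell'>0$) is $$\mathcal{E}_{\rm a}(y)=\varepsilon\sum_{\ell=-N+1}^N\big(\phi(y_\ell')+\phi(y_\ell'+y_{\ell+1}')\big).$$ Stable equilibrium: for $\mathcal{E}:\mathcal{Y}_F\to\mathbb{R}\cup\{+\infty\}$,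 $y\in\mathcal{Y}_F$ is a stable equilibrium of $\mathcal{E}$ if $\mathcal{E}$ is twice differentiable at $y$, the first variation satisfies $\mathcal{E}'(y)[u]=0$ for all $u\in\mathcal{U}$, and the second variation satisfies $\mathcal{E}''(y)[u,u]>0$ for all $u\in\mathcal{U}\setminus\{0\}$. *)

(* Defs.v *)
From HB Require Import structures.
From mathcomp Require Import all_boot all_order all_algebra.
From mathcomp Require Import all_classical all_reals all_analysis.

Set Implicit Arguments.
Unset Strict Implicit.
Unset Printing Implicit Defensive.

Import Order.TTheory GRing.Theory Num.Theory.
Import numFieldNormedType.Exports.

Local Open Scope classical_set_scope.
Local Open Scope ring_scope.

(* [phi] is a total function, but only its values on (0, +oo) matter.  Only
   convergence to 0, at no prescribed rate, is required of the derivatives at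
   infinity: this is implied by rapid decay in any sense. *)
Record interaction_potential (R : realType) (rstar : R) (phi : R -> R) : Prop :=
  InteractionPotential {
    potential_derivable :
      forall (k : nat) (r : R), (k < 4)%N -> 0 < r -> derivable (derive1n k phi) r 1;
    potential_C4 : forall r : R, 0 < r -> {for r, continuous (derive1n 4 phi)};
    rstar_gt0 : 0 < rstar;
    potential_convex :
      convex_function
        ([set r : R | 0 < r < rstar] : set (convex_lmodType R^o)) phi;
    potential_concave :
      convex_function
        ([set r : R | rstar < r] : set (convex_lmodType R^o)) (\- phi);
    potential_decay :
      forall k : nat, (k <= 4)%N -> derive1n k phi r @[r --> +oo] --> (0 : R) }.

Definition spacing (R : realType) (N : nat) : R := N%:R^-1.

Definition bdiff (R : realType) (N : nat) (v : int -> R) (l : int) : R :=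
  (v l - v (l - 1)) / spacing R N.

(* sum over -N+1 <= l <= N *)
Definition period_sum (R : realType) (N : nat) (f : int -> R) : R :=
  \sum_(k < 2 * N) f (k%:Z - N%:Z + 1).

Definition displ_pred (R : realType) (N : nat) : {pred int -> R} :=
  [pred u : int -> R |
    `[< (forall l : int, u (l + (2 * N)%:Z) = u l) /\ period_sum N u = 0 >]].

(* The space U.  The positivity of [N] is a parameter of the type because it is
   needed for the norm below to be definite. *)
Record displacement (R : realType) (N : nat) (N_gt0 : (0 < N)%N) := Displacement {
  displ_val :> int -> R;
  displ_valP : displ_val \in displ_pred N }.

Section DisplacementSpace.
Context {R : realType} (N : nat) (N_gt0 : (0 < N)%N).

HB.instance Definition _ := [isSub for @displ_val R N N_gt0].
HB.instance Definition _ := [Choice of displacement R N_gt0 by <:].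

Fact displ_submod_closed : submod_closed (@displ_pred R N).
Proof.
split=> [|a u v].
  by apply/asboolP; split=> //; rewrite /period_sum big1.
move=> /asboolP[uP u0] /asboolP[vP v0]; apply/asboolP; split=> [l|].
  by rewrite !fctE uP vP.
rewrite /period_sum; under eq_bigr do rewrite !fctE.
rewrite big_split /= -scaler_sumr.
by move: u0 v0; rewrite /period_sum => -> ->; rewrite scaler0 addr0.
Qed.

HB.instance Definition _ :=
  GRing.isSubmodClosed.Build R (int -> R^o) (@displ_pred R N) displ_submod_closed.
HB.instance Definition _ :=
  [SubChoice_isSubLmodule of displacement R N_gt0 by <:].

(* The l^1 norm over a period.  U is finite-dimensional, so differentiability
   does not depend on the choice of norm. *)
Definition displ_norm (u : displacement R N_gt0) : R :=
  period_sum N (fun l => `|u l|).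

Fact displ_norm_ler_normD (u v : displacement R N_gt0) :
  displ_norm (u + v) <= displ_norm u + displ_norm v.
Proof.
rewrite /displ_norm /period_sum -big_split /=.
by apply: ler_sum => k _; rewrite ler_normD.
Qed.

Fact displ_norm_normrZ (a : R) (u : displacement R N_gt0) :
  displ_norm (a *: u) = `|a| * displ_norm u.
Proof.
rewrite /displ_norm /period_sum mulr_sumr.
by apply: eq_bigr => k _; rewrite -normrM.
Qed.

Fact displ_norm_normr0_eq0 (u : displacement R N_gt0) :
  displ_norm u = 0 -> u = 0.
Proof.
rewrite /displ_norm /period_sum => /eqP; rewrite psumr_eq0// => /allP u0.
have N0 : (N%:Z != 0) by rewrite eqz_nat -lt0n.
have N20 : ((2 * N)%:Z != 0) by rewrite eqz_nat muln_eq0 /= -lt0n.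
have per : forall l : int, u (l + (2 * N)%:Z) = u l.
  by have /asboolP[] := displ_valP u.
have perk (k : nat) (l : int) : u (l + k%:Z * (2 * N)%:Z) = u l.
  elim: k l => [|k IH] l; first by rewrite mul0r addr0.
  by rewrite -addn1 PoszD mulrDl mul1r addrA per IH.
have perz (z l : int) : u (l + z * (2 * N)%:Z) = u l.
  case: z => k; first exact: perk.
  by rewrite NegzE -[LHS](perk k.+1) mulNr subrK.
apply: val_inj; apply/funext => l /=.
set m := l + N%:Z - 1.
have m0 : 0 <= (m %% (2 * N)%:Z)%Z by exact: modz_ge0.
have mlt : (m %% (2 * N)%:Z)%Z < (2 * N)%:Z.
  by rewrite ltz_pmod// lt_neqAle eq_sym N20.
have [k km] : exists k : nat, (m %% (2 * N)%:Z)%Z = k%:Z.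
  by exists `|(m %% (2 * N)%:Z)%Z|%N; rewrite gez0_abs.
rewrite km ltz_nat in mlt.
have /implyP/(_ isT)/= := u0 (Ordinal mlt) (mem_index_enum _).
rewrite normr_eq0 => /eqP uk0; apply: etrans uk0.
rewrite -[RHS](perz (m %/ (2 * N)%:Z)%Z); congr (displ_val _ _).
rewrite -km addrC addrA addrA -divz_eq /m.
by rewrite addrAC subrK addrK.
Qed.

HB.instance Definition _ :=
  Lmodule_isNormed.Build R (displacement R N_gt0)
    displ_norm_ler_normD displ_norm_normrZ displ_norm_normr0_eq0.

End DisplacementSpace.

Definition yF (R : realType) (N : nat) (F : R) : int -> R :=
  fun l => F * l%:~R * spacing R N.

Definition deformations (R : realType) (N : nat) (N_gt0 : (0 < N)%N) (F : R) :
    set (int -> R) :=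
  [set y | exists u : displacement R N_gt0, y = (fun l => yF N F l + u l)].

Definition atomistic_energy (R : realType) (N : nat) (phi : R -> R)
    (y : int -> R) : \bar R :=
  if `[< forall l : int, 0 < bdiff N y l >] then
    (spacing R N * period_sum N (fun l =>
       phi (bdiff N y l) + phi (bdiff N y l + bdiff N y (l + 1))))%:E
  else +oo%E.

(* [B] is the second Frechet derivative of [f] at [x]: the derivative of
   [z |-> 'd f z] at [x] with respect to the operator norm on the dual. *)
Definition second_derivative_at (R : realType) (V : normedModType R)
    (f : V -> R^o) (x : V) (B : {bilinear V -> V -> R^o}) : Prop :=
  [/\ \forall z \near x, differentiable f z,
      continuous (fun p : V * V => B p.1 p.2) &
      forall e : R, 0 < e -> \forall h \near (0 : V), forall v : V,
        `|'d f (x + h) v - 'd f x v - B h v| <= e * `|h| * `|v|].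

(* Y_F is an affine space over U: derivatives of E at y are those of
   u |-> E (y + u) at 0.  Only the values of [E] on Y_F matter, and [fine] is
   harmless because [E] is required to be finite near y. *)
Definition stable_equilibrium (R : realType) (N : nat) (N_gt0 : (0 < N)%N)
    (F : R) (E : (int -> R) -> \bar R) (y : int -> R) : Prop :=
  let U := displacement R N_gt0 in
  let Ey := fun u : U => E (fun l => y l + u l) in
  let f := (fun u : U => fine (Ey u)) : U -> R^o in
  [/\ deformations N_gt0 F y,
      \forall u \near (0 : U), Ey u \is a fin_num &
      exists B : {bilinear U -> U -> R^o},
        [/\ second_derivative_at f 0 B,
            forall u : U, 'd f (0 : U) u = 0 &
            forall u : U, u != 0 -> 0 < B u u]].

Definition A_F (R : realType) (phi : R -> R) (F : R) : R :=
  derive1n 2 phi F + 4 * derive1n 2 phi (2 * F).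

Definition mu (R : realType) (N : nat) : R :=
  2 * sin (pi * spacing R N / 2) / spacing R N.

(* Main.v *)
From HB Require Import structures.
Require Import Defs.
From mathcomp Require Import all_boot all_order all_algebra.
From mathcomp Require Import all_classical all_reals all_analysis.
From mathcomp Require Import ring lra zify.

Set Implicit Arguments.
Unset Strict Implicit.
Unset Printing Implicit Defensive.

Import Order.TTheory GRing.Theory Num.Theory.
Import numFieldNormedType.Exports.

Local Open Scope classical_set_scope.
Local Open Scope ring_scope.

(** The second variation at the homogeneous deformation only involves the
strains w_l = u_l', and completing squares,
  (w_l + w_(l+1))^2 = 2 w_l^2 + 2 w_(l+1)^2 - (w_(l+1) - w_l)^2,
turns it, after summation over a period, into
  eps * (A_F * sum w_l^2 - phi''(2F) * sum (w_(l+1) - w_l)^2)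
([link_hessian_diag]).  Strains of displacements are periodic and have mean
zero.  On such sequences the discrete Wirtinger inequality
  sum (w_(l+1) - w_l)^2 >= (2 - 2 cos (pi / N)) * sum w_l^2
holds ([discrete_wirtinger]), and its constant is eps^2 mu_eps^2 ([mu_cos]).
As phi''(2F) <= 0, the second variation is at least
eps * (A_F - eps^2 mu_eps^2 phi''(2F)) * sum w_l^2, where the last sum is
positive for u <> 0 ([sum_bdiff_sqr_gt0]): this is sufficiency.  The
displacement l |-> cos (pi l / N) gives equality in Wirtinger's inequality
([cosine_mode_eigen]), which is necessity.

Wirtinger's inequality follows from Parseval's identity for the real discrete
Fourier transform: taking a forward difference multiplies the j-th spectral
component by 2 - 2 cos (pi j / N), the component j = 0 vanishes because the
mean does, and among 0 < j < 2N the multiplier is least at j = 1.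

What remains is to know that the energy is twice Frechet differentiable at the
homogeneous deformation with the expected derivatives
([stable_equilibrium_hessian]).  Near that deformation all strains are
positive, so the energy is a finite sum of smooth functions of continuous
linear forms, for which the second derivative is computed in general
([second_derivative_link_energy]).  The first variation vanishes because the
strains of a displacement sum to zero.  Since stability asserts the existence
of some second derivative that is positive, necessity also uses that second
derivatives are unique ([second_derivative_unique]). *)

(** * Sums over a period *)

Section PeriodSum.
Context {R : realType} (N : nat).
Implicit Types f g : int -> R.

Lemma eq_period_sum f g : f =1 g -> period_sum N f = period_sum N g.
Proof. by move=> fg; apply: eq_bigr => k _; exact: fg. Qed.

Lemma period_sumD f g :
  period_sum N (fun l => f l + g l) = period_sum N f + period_sum N g.
Proof. exact: big_split. Qed.

Lemma period_sumZ (c : R) f :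
  period_sum N (fun l => c * f l) = c * period_sum N f.
Proof. by rewrite /period_sum mulr_sumr. Qed.

Lemma period_sum_ge0 f : (forall l, 0 <= f l) -> 0 <= period_sum N f.
Proof. by move=> f0; apply: sumr_ge0. Qed.

Lemma period_sum_shift f :
  periodic f (2 * N)%:Z -> period_sum N (fun l => f (l + 1)) = period_sum N f.
Proof.
move=> fP; rewrite /period_sum; case: N fP => [|n] fP.
  by rewrite !big_ord0.
rewrite mulnS add2n in fP *; rewrite big_ord_recr/= [RHS]big_ord_recl/= addrC.
congr (_ + _).
  by rewrite -[RHS]fP; congr f => /=; lia.
by apply: eq_bigr => k _; congr f; rewrite /bump /=; lia.
Qed.

End PeriodSum.

(** * Discrete Fourier transform and Wirtinger's inequality *)

Section RealFourier.
Context {R : realType} (N : nat).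
Hypothesis N_gt0 : (0 < N)%N.

Local Notation theta := (pi / N%:R : R).

Let N_neq0 : N%:R != 0 :> R. Proof. by rewrite pnatr_eq0 -lt0n. Qed.

(** Telescoping: 2 sin a cos (2 a j) = sin ((2 j + 1) a) - sin ((2 j - 1) a). *)
Lemma dirichlet_kernel (a : R) n :
  2 * sin a * (\sum_(j < n) cos (2 * a * j%:R)) = sin (2 * a * n%:R - a) + sin a.
Proof.
elim: n => [|n IH]; first by rewrite big_ord0 !mulr0 sub0r sinN addNr.
rewrite big_ord_recr/= mulrDr IH -[n.+1]addn1 natrD mulrDr mulr1.
have -> : 2 * a * n%:R + 2 * a - a = 2 * a * n%:R + a by ring.
by rewrite [in LHS]sinB [in RHS]sinD; ring.
Qed.

(** Orthogonality of the modes: with a = pi d / (2 N), the two sines of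
    [dirichlet_kernel] cancel after a full period, and sin a <> 0. *)
Lemma sum_cos_eq0 (d : nat) : (0 < d < 2 * N)%N ->
  \sum_(j < 2 * N) cos (theta * j%:R * d%:R) = 0.
Proof.
move=> /andP[d0 dN]; pose a := theta * d%:R / 2.
have sin_a : 0 < sin a.
  apply: sin_gt0_pi; rewrite /a !divr_gt0 ?mulr_gt0 ?invr_gt0 ?pi_gt0 ?ltr0n//=.
  rewrite ltr_pdivrMr// mulrAC ltr_pdivrMr ?ltr0n// -mulrA ltr_pM2l ?pi_gt0//.
  by rewrite -natrM ltr_nat.
have /eqP := dirichlet_kernel a (2 * N).
have -> : 2 * a * (2 * N)%:R - a = - a + pi *+ 2 *+ d.
  by rewrite /a natrM -[pi *+ 2 *+ d]mulr_natr; field.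
rewrite (periodicn (@sinD2pi R)) sinN addNr !mulf_eq0 pnatr_eq0/= gt_eqF//=.
move=> /eqP {2}<-; apply: eq_bigr => j _; congr cos.
by rewrite /a; field.
Qed.

Definition cos_coeff_at (j : nat) (w : int -> R) :=
  period_sum N (fun l => w l * cos (theta * j%:R * l%:~R)).
Definition sin_coeff_at (j : nat) (w : int -> R) :=
  period_sum N (fun l => w l * sin (theta * j%:R * l%:~R)).
(** The squared modulus of the j-th coefficient of the complex discrete Fourier
    transform on Z / 2N. *)
Definition spectrum (j : nat) w := cos_coeff_at j w ^+ 2 + sin_coeff_at j w ^+ 2.

(** Expanding both squares, cos * cos + sin * sin depends on the two indices only
    through their difference, so that the sum over j kills all off-diagonal
    terms by orthogonality. *)
Lemma parseval w :
  \sum_(j < 2 * N) spectrum j w = (2 * N)%:R * period_sum N (fun l => w l ^+ 2).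
Proof.
pose x (k : 'I_(2 * N)) : int := k%:Z - N%:Z + 1.
have spectrumE (j : nat) : spectrum j w =
    \sum_(k < 2 * N) \sum_(l < 2 * N)
      w (x k) * w (x l) * cos (theta * j%:R * (x k - x l)%:~R).
  rewrite /spectrum !expr2 /cos_coeff_at /sin_coeff_at /period_sum.
  rewrite !big_distrlr/= -big_split/=; apply: eq_bigr => k _.
  rewrite -big_split/=; apply: eq_bigr => l _.
  by rewrite rmorphB/= mulrBr cosB; ring.
under eq_bigr do rewrite spectrumE.
rewrite exchange_big/= /period_sum mulr_sumr; apply: eq_bigr => k _.
rewrite exchange_big/= (bigD1 k)//= [X in _ + X]big1 ?addr0 => [|l lk].
  under eq_bigr do rewrite subrr mulr0 cos0 mulr1.
  by rewrite sumr_const card_ord -[LHS]mulr_natl -expr2.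
rewrite -mulr_sumr.
suff -> : \sum_(j < 2 * N) cos (theta * j%:R * (x k - x l)%:~R) = 0 by rewrite mulr0.
have -> : x k - x l = k%:Z - l%:Z by rewrite /x; lia.
have [kl|lk'] := leqP k l.
  under eq_bigr do rewrite -cosN -mulrN -rmorphN/= opprB subzn// -pmulrn.
  by rewrite sum_cos_eq0//; move: (ltn_ord l) lk; rewrite -val_eqE/=; lia.
under eq_bigr do rewrite subzn 1?ltnW// -pmulrn.
by rewrite sum_cos_eq0//; move: (ltn_ord k); lia.
Qed.

Let trig_arg (j : nat) (l : int) :
  theta * j%:R * (l + (2 * N)%:Z)%:~R = theta * j%:R * l%:~R + pi *+ 2 *+ j.
Proof.
by rewrite rmorphD/= mulrDr -pmulrn natrM -[pi *+ 2 *+ j]mulr_natr; field.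
Qed.

Lemma periodic_cos j :
  periodic (fun l : int => cos (theta * j%:R * l%:~R)) (2 * N)%:Z.
Proof. by move=> l; rewrite trig_arg (periodicn (@cosD2pi R)). Qed.

Lemma periodic_sin j :
  periodic (fun l : int => sin (theta * j%:R * l%:~R)) (2 * N)%:Z.
Proof. by move=> l; rewrite trig_arg (periodicn (@sinD2pi R)). Qed.

(** A shift by one rotates the pair (cosine coefficient, sine coefficient) by the
    angle t = pi j / N, and |e^(i t) - 1|^2 = 2 - 2 cos t. *)
Lemma spectrum_diff j w : periodic w (2 * N)%:Z ->
  spectrum j (fun l => w (l + 1) - w l) =
  (2 - 2 * cos (theta * j%:R)) * spectrum j w.
Proof.
move=> wP; set t := theta * j%:R.
pose C l := cos (t * l%:~R); pose S l := sin (t * l%:~R).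
have CP : periodic C (2 * N)%:Z by exact: periodic_cos.
have SP : periodic S (2 * N)%:Z by exact: periodic_sin.
have eC : cos_coeff_at j (fun l => w (l + 1) - w l) =
    (cos t - 1) * cos_coeff_at j w + sin t * sin_coeff_at j w.
  pose f l := w l * (C l * cos t + S l * sin t).
  have fP : periodic f (2 * N)%:Z by move=> l; rewrite /f wP CP SP.
  transitivity (period_sum N (fun l => f (l + 1) + -1 * (w l * C l))).
    apply: eq_period_sum => l; rewrite /f -cosB rmorphD/= mulrDr mulr1 addrK.
    by rewrite -/t -/(C l); ring.
  rewrite period_sumD period_sumZ (period_sum_shift fP).
  rewrite (eq_period_sum _ (g := fun l => cos t * (w l * C l) + sin t * (w l * S l))).
    by rewrite period_sumD !period_sumZ /cos_coeff_at /sin_coeff_at -/t; ring.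
  by move=> l; rewrite /f; ring.
have eS : sin_coeff_at j (fun l => w (l + 1) - w l) =
    (cos t - 1) * sin_coeff_at j w - sin t * cos_coeff_at j w.
  pose f l := w l * (S l * cos t - C l * sin t).
  have fP : periodic f (2 * N)%:Z by move=> l; rewrite /f wP CP SP.
  transitivity (period_sum N (fun l => f (l + 1) + -1 * (w l * S l))).
    apply: eq_period_sum => l; rewrite /f -sinB rmorphD/= mulrDr mulr1 addrK.
    by rewrite -/t -/(S l); ring.
  rewrite period_sumD period_sumZ (period_sum_shift fP).
  rewrite (eq_period_sum _ (g := fun l => cos t * (w l * S l) + (- sin t) * (w l * C l))).
    by rewrite period_sumD !period_sumZ /cos_coeff_at /sin_coeff_at -/t; ring.
  by move=> l; rewrite /f; ring.
rewrite /spectrum eC eS; have := cos2Dsin2 t.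
set c := cos t; set s := sin t => cs.
have -> : 2 - 2 * c = (c - 1) ^+ 2 + s ^+ 2 by lra.
by ring.
Qed.

(** The cosine decreases on [0, pi]; frequencies j > N are folded back by
    cos (pi j / N) = cos (pi (2 N - j) / N). *)
Lemma cos_freq_le (j : nat) : (0 < j < 2 * N)%N -> cos (theta * j%:R) <= cos theta.
Proof.
have th0 : 0 < theta by rewrite divr_gt0 ?pi_gt0 ?ltr0n.
have thpi : theta * N%:R = pi by rewrite divfK.
have decr (i : nat) : (0 < i <= N)%N -> cos (theta * i%:R) <= cos theta.
  move=> /andP[i0 iN].
  have le1 : theta <= theta * i%:R by rewrite ler_peMr ?ler1n// ltW.
  have le2 : theta * i%:R <= pi by rewrite -[leRHS]thpi ler_pM2l// ler_nat.
  have [<- //|lt1] := eqVneq theta (theta * i%:R).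
  apply/ltW; rewrite ltr_cos ?in_itv/= ?le2 ?(le_trans le1 le2) ?(ltW th0)//.
    by rewrite lt_neqAle lt1.
  by rewrite (le_trans (ltW th0)).
move=> /andP[j0 jN]; have [jlN|Nj] := leqP j N; first by rewrite decr ?j0.
have -> : cos (theta * j%:R) = cos (theta * (2 * N - j)%:R).
  rewrite natrB 1?ltnW// natrM mulrBr mulrCA thpi -mulr_natl -cosN -(cosD2pi (- _)).
  by congr cos; rewrite -mulr_natl; ring.
by apply: decr; lia.
Qed.

(** Termwise comparison after Parseval: the term j = 0 vanishes because [w] has
    mean zero, and the others have multiplier at least that of j = 1. *)
Theorem discrete_wirtinger (w : int -> R) :
  periodic w (2 * N)%:Z -> period_sum N w = 0 ->
  (2 - 2 * cos theta) * period_sum N (fun l => w l ^+ 2) <=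
  period_sum N (fun l => (w (l + 1) - w l) ^+ 2).
Proof.
move=> wP w0; have N2 : 0 < (2 * N)%:R :> R by rewrite ltr0n muln_gt0.
rewrite -(ler_pM2l N2) mulrCA -!parseval mulr_sumr.
apply: ler_sum => j _; rewrite spectrum_diff//.
have sp0 : 0 <= spectrum j w by rewrite addr_ge0 ?sqr_ge0.
have [j0|j0] := posnP j.
  have c0 : cos_coeff_at j w = 0.
    by rewrite -w0; apply: eq_period_sum => l; rewrite j0 mulr0 mul0r cos0 mulr1.
  have s0 : sin_coeff_at j w = 0.
    by apply: big1 => k _; rewrite j0 mulr0 mul0r sin0 mulr0.
  by rewrite /spectrum c0 s0 expr0n/= addr0 !mulr0.
rewrite ler_wpM2r// lerD2l lerN2 ler_pM2l//.
by rewrite cos_freq_le// j0 ltn_ord.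
Qed.

End RealFourier.

(** * Second derivatives of sums of functions of linear forms *)

Section SecondDerivative.
Context {R : realType} {V : normedModType R}.
Implicit Types f g : V -> R^o.

Lemma diff_approx f x e : differentiable f x -> 0 < e ->
  \forall h \near (0 : V), `|f (x + h) - f x - 'd f x h| <= e * `|h|.
Proof.
move=> /diff_locally /eqaddoP/(_ e) dfx e0; near=> h.
have : `|((f \o shift x) - (cst (f x) + 'd f x)) h| <= e * `|h|.
  by near: h; exact: dfx.
by rewrite /= !fctE/= opprD addrA [h + x]addrC.
Unshelve. all: by end_near. Qed.

(** Differentials are defined by a choice operator, so locality needs a proof. *)
Lemma near_eq_is_diff f g df x :
  {near x, f =1 g} -> is_diff x f df -> is_diff x g df.
Proof.
move=> fg [dfx dfE].
have loc : g \o shift x = cst (g x) + 'd f x +o_ 0 id.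
  apply/eqaddoP => e e0.
  have fgx : f x = g x by exact: nbhs_singleton fg.
  have fg0 : \forall h \near (0 : V), f (x + h) = g (x + h).
    exact: (proj1 (nbhs0P (fun z => f z = g z) x) fg).
  near=> h; rewrite /= !fctE/= opprD addrA [h + x]addrC -fgx.
  have <- : f (x + h) = g (x + h) by near: h.
  by near: h; exact: diff_approx.
have dE : 'd g x = 'd f x :> (V -> R^o).
  by apply: diff_unique => //; exact: diff_continuous.
split; last by rewrite dE.
by apply/diff_locallyP; rewrite dE; split=> //; exact: diff_continuous.
Unshelve. all: by end_near. Qed.

(** Subtracting the two expansions at h = t u leaves
    |t| |B u v - B' u v| <= 2 e |t| |u| |v|; divide by |t| and let e tend to 0. *)
Lemma second_derivative_unique f x (B B' : {bilinear V -> V -> R^o}) :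
  second_derivative_at f x B -> second_derivative_at f x B' ->
  forall u v, B u v = B' u v.
Proof.
move=> [_ _ dB] [_ _ dB'] u v; apply/eqP; rewrite -subr_eq0 -normr_le0.
apply/ler_addgt0Pr => e e0; rewrite add0r.
(* The + 1 keeps the denominator positive when u or v vanishes. *)
pose e1 := e / (2 * (`|u| * `|v| + 1)).
have uv0 : 0 < 2 * (`|u| * `|v| + 1) by rewrite mulr_gt0 // ltr_wpDl // mulr_ge0.
have e10 : 0 < e1 by exact: divr_gt0.
have : \forall t \near (0 : R), t != 0 -> `|B u v - B' u v| <= e.
  have near_bound (C : {bilinear V -> V -> R^o}) :
      (forall e : R, 0 < e -> \forall h \near (0 : V), forall v : V,
        `|'d f (x + h) v - 'd f x v - C h v| <= e * `|h| * `|v|) ->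
      \forall t \near (0 : R), `|'d f (x + t *: u) v - 'd f x v - t * C u v|
        <= e1 * (`|t| * `|u|) * `|v|.
    move=> dC; have := near0Z u (dC _ e10); apply: filterS => t /(_ v).
    by rewrite linearZl normrZ.
  have bB := near_bound _ dB; have bB' := near_bound _ dB'.
  near=> t => t0; have nt0 : 0 < `|t| by rewrite normr_gt0.
  rewrite -(ler_pM2l nt0) -normrM mulrBr.
  have : `|'d f (x + t *: u) v - 'd f x v - t * B u v| <= e1 * (`|t| * `|u|) * `|v| by near: t.
  have : `|'d f (x + t *: u) v - 'd f x v - t * B' u v| <= e1 * (`|t| * `|u|) * `|v| by near: t.
  set D := 'd f (x + t *: u) v - 'd f x v => h2 h1.
  have -> : t * B u v - t * B' u v = (D - t * B' u v) - (D - t * B u v) by ring.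
  rewrite (le_trans (ler_normB _ _))// (le_trans (lerD h2 h1))//.
  have -> : e1 * (`|t| * `|u|) * `|v| + e1 * (`|t| * `|u|) * `|v| =
    `|t| * (2 * (`|u| * `|v|) * e1) by ring.
  rewrite ler_pM2l// /e1 [X in X <= _]mulrA ler_pdivrMr// mulrC ler_pM2l//.
  by rewrite ler_pM2l// lerDl.
move=> P; near (0 : R)^' => t.
have t0 : t != 0 by near: t; exact: nbhs_dnbhs_neq.
by move: t0; near: t; exact: nbhs_dnbhs.
Unshelve. all: by end_near. Qed.

Lemma near_eq_second_derivative f g x (B : {bilinear V -> V -> R^o}) :
  {near x, f =1 g} -> second_derivative_at f x B -> second_derivative_at g x B.
Proof.
move=> /near_join fg [df cB dB].
have dfg : \forall z \near x, is_diff z g ('d f z).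
  near=> z; apply: (@near_eq_is_diff f); first by near: z.
  by apply: differentiableP; near: z.
split=> //.
  by apply: filterS dfg => z [].
move=> e e0.
have dx : 'd g x = 'd f x :> (V -> R^o) by case: (nbhs_singleton dfg).
have dfg0 : \forall h \near (0 : V), is_diff (x + h) g ('d f (x + h)).
  exact: (proj1 (nbhs0P (fun z => is_diff z g ('d f z)) x) dfg).
near=> h => v.
have [_ ->] : is_diff (x + h) g ('d f (x + h)) by near: h.
by rewrite dx; move: v; near: h; exact: dB.
Unshelve. all: by end_near. Qed.

End SecondDerivative.

Section LinkEnergy.
Context {R : realType} {V : normedModType R} {I : finType}.
Variables (L : I -> {linear V -> R^o}) (a : I -> R) (c : R) (g : R -> R).
Hypothesis L_cont : forall i, continuous (L i).

(** Links [i] of rest length [a i], stretched by the linear form [L i], all with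
    the same interaction potential [g]. *)
Definition link_energy (u : V) : R^o := c * \sum_i g (a i + L i u).

Definition link_hessian (u v : V) : R^o :=
  c * \sum_i g^`(2)%classic (a i) * (L i u * L i v).

Let link_hessian_bilinear : bilinear_for
  (GRing.Scale.Law.clone _ _ *:%R _) (GRing.Scale.Law.clone _ _ *:%R _)
  link_hessian.
Proof.
split=> [v|v] k u w; rewrite /link_hessian /= scalerAr scaler_sumr -mulrDr.
  rewrite -big_split; congr (_ * _); apply: eq_bigr => i _ /=.
  by rewrite linearP /GRing.scale/=; ring.
rewrite -big_split; congr (_ * _); apply: eq_bigr => i _ /=.
by rewrite linearP /GRing.scale/=; ring.
Qed.
HB.instance Definition _ := bilinear_isBilinear.Build R V V R^o _ _
  link_hessian link_hessian_bilinear.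

Lemma is_diff_comp_affine (h : R -> R) (l : {linear V -> R^o}) b z :
  continuous l -> derivable h (b + l z) 1 ->
  is_diff z ((fun u => h (b + l u)) : V -> R^o)
    (fun v => h^`()%classic (b + l z) * l v).
Proof.
move=> lc dh.
have dl : is_diff z (l : V -> R^o) l.
  by split; [exact: linear_differentiable|rewrite diff_lin].
have dbl : is_diff z (cst (b : R^o) + (l : V -> R^o)) (0 + (l : V -> R^o)).
  exact: is_diffD.
have dh' : is_diff (b + l z) (h : R^o -> R^o) ( *:%R^~ (h^`()%classic (b + l z))).
  split; first exact/derivable1_diffP.
  exact: deriv1E.
have dE : *:%R^~ (h^`()%classic (b + l z)) \o (0 + (l : V -> R^o)) =
    (fun v => h^`()%classic (b + l z) * l v).
  by apply/funext => v /=; rewrite /GRing.scale/= !fctE add0r mulrC.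
have hcomp := is_diff_comp dbl dh'.
exact: (is_diff_eq hcomp dE).
Qed.

Lemma is_diff_sum (J : finType) (f df : J -> V -> R^o) z :
  (forall j, is_diff z (f j) (df j)) ->
  is_diff z (fun u => \sum_j f j u) (fun v => \sum_j df j v).
Proof.
move=> fd; rewrite -!fct_sumE.
elim/big_ind2: _ => [|f1 df1 f2 df2 d1 d2|j _]; last exact: fd.
  exact: is_diff_cst.
exact: is_diffD.
Qed.

Hypothesis g_near : forall i, \forall t \near a i, derivable g t 1.
Hypothesis g_twice : forall i, derivable (g^`()%classic) (a i) 1.

Lemma is_diff_link_energy : \forall z \near (0 : V),
  is_diff z link_energy (fun v => c * \sum_i g^`()%classic (a i + L i z) * L i v).
Proof.
have gL i : \forall z \near (0 : V), derivable g (a i + L i z) 1.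
  have : (fun z => a i + L i z) @ (0 : V) --> a i.
    rewrite -[in X in _ --> X](addr0 (a i)) -(linear0 (L i)).
    by apply: cvgD; [exact: cvg_cst|exact: L_cont].
  by move=> /(_ _ (g_near i)).
apply: filterS (@filter_forall V I _ (nbhs (0 : V)) _ gL) => z dg.
have := is_diff_sum (fun i => is_diff_comp_affine (@L_cont i) (dg i)).
move/(is_diffZ c); exact.
Qed.

(** The differential is a sum of the forms [L i] with coefficients
    g' (a i + L i h), and each coefficient is differentiable in h at 0. *)
Lemma second_derivative_link_energy :
  second_derivative_at link_energy 0 link_hessian.
Proof.
have d1 := is_diff_link_energy.
have L0 i : L i 0 = 0 by rewrite linear0.
split.
- by apply: filterS d1 => z [].
- move=> p; apply: cvgM; first exact: cvg_cst.
  apply: cvg_big => [|i _]; first exact: add_continuous.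
  apply: cvgM; first exact: cvg_cst.
  apply: cvgM.
    by apply: continuous_comp; [exact: cvg_fst|exact: L_cont].
  by apply: continuous_comp; [exact: cvg_snd|exact: L_cont].
move=> e e0.
(* One bound for the operator norms of all the forms. *)
have [K K0 LK] : exists2 K : R, 0 < K & forall i v, `|L i v| <= K * `|v|.
  have /choice[k kP] : forall i, exists k : R, 0 < k /\ forall v, `|L i v| <= k * `|v|.
    by move=> i; have [k k0 kL] := linear_lipschitz (@L_cont i); exists k.
  exists (1 + \sum_i k i) => [|i v].
    by rewrite ltr_pwDl// sumr_ge0// => i _; have [/ltW] := kP i.
  have [_ /(_ v)/le_trans] := kP i; apply.
  rewrite ler_wpM2r// (bigD1 i)//= addrCA lerDl addr_ge0// sumr_ge0// => j _.
  by have [/ltW] := kP j.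
(* The constants multiply up to |c| #|I| K d <= e when d = e / m; the + 1 makes
   m positive. *)
pose m : R := `|c| * #|I|%:R * K + 1.
have m0 : 0 < m by rewrite ltr_wpDl// !mulr_ge0// ltW.
pose d := e / m.
have d0 : 0 < d by exact: divr_gt0.
have gh i : \forall h \near (0 : V),
    `|g^`()%classic (a i + L i h) - g^`()%classic (a i) - g^`(2)%classic (a i) * L i h| <= d * `|h|.
  have gi : derivable (g^`()%classic) (a i + L i 0) 1 by rewrite L0 addr0.
  have [dg dgE] := is_diff_comp_affine (@L_cont i) gi.
  have := diff_approx dg d0; apply: filterS => h.
  by rewrite dgE add0r L0 addr0.
have [_ diff0E] := nbhs_singleton d1.
have gh_all := @filter_forall V I _ (nbhs (0 : V)) _ gh.
near=> h => v.
have [_ dh] : is_diff h link_energy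
    (fun v => c * \sum_i g^`()%classic (a i + L i h) * L i v) by near: h.
have ghh : forall i, `|g^`()%classic (a i + L i h) - g^`()%classic (a i) -
    g^`(2)%classic (a i) * L i h| <= d * `|h| by near: h; exact: gh_all.
rewrite add0r dh diff0E.
rewrite /link_hessian -!mulrBr -!sumrB normrM.
apply: (@le_trans _ _ (`|c| * \sum_(i : I) d * `|h| * (K * `|v|))).
  rewrite ler_wpM2l//; apply: (le_trans (ler_norm_sum _ _ _)).
  apply: ler_sum => i _; rewrite L0 addr0.
  rewrite [_ * (L i h * _)]mulrA -!mulrBl normrM.
  by rewrite ler_pM.
rewrite sumr_const -[_ *+ _]mulr_natl.
have -> : `|c| * (#|I|%:R * (d * `|h| * (K * `|v|))) = (m - 1) * d * `|h| * `|v|.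
  by rewrite /m; ring.
rewrite !ler_wpM2r// -[leRHS](divfK (lt0r_neq0 m0)) -/d mulrC ler_pM2l//.
by rewrite gerBl.
Unshelve. all: by end_near. Qed.

End LinkEnergy.

(** * The atomistic energy *)

Lemma periodic_window (T : zmodType) (N : nat) (f : int -> T) (l : int) :
  (0 < N)%N -> periodic f (2 * N)%:Z ->
  exists k : 'I_(2 * N), f l = f (k%:Z - N%:Z + 1).
Proof.
move=> N_gt0 fP.
have fPz (z m : int) : f (m + z * (2 * N)%:Z) = f m.
  case: z => n.
    by rewrite -[RHS](periodicn fP n) -[_ *+ n]mulr_natl natz.
  rewrite -[LHS](periodicn fP n.+1) -[_ *+ n.+1]mulr_natl natz NegzE; congr f.
  by rewrite mulNr addrNK.
have N2 : (2 * N)%:Z != 0 by lia.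
pose m := ((l + N%:Z - 1) %% (2 * N)%:Z)%Z.
have m0 : 0 <= m by exact: modz_ge0.
have mlt : (`|m| < 2 * N)%N.
  by have : m < (2 * N)%:Z; [apply: ltz_pmod; lia | lia].
exists (Ordinal mlt) => /=; rewrite gez0_abs//.
rewrite -(fPz ((l + N%:Z - 1) %/ (2 * N)%:Z)%Z (m - N%:Z + 1)); congr f.
by have := divz_eq (l + N%:Z - 1) (2 * N)%:Z; rewrite -/m; lia.
Qed.

Section Atomistic.
Context {R : realType} (N : nat) (N_gt0 : (0 < N)%N).
Local Notation U := (displacement R N_gt0).
Local Notation eps := (spacing R N).
Implicit Types u v : U.

Let eps_gt0 : 0 < eps. Proof. by rewrite invr_gt0 ltr0n. Qed.
Let eps_neq0 : eps != 0. Proof. exact: lt0r_neq0. Qed.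

Lemma displ_periodic u : periodic u (2 * N)%:Z.
Proof. by have /asboolP[] := displ_valP u. Qed.

Lemma displ_sum0 u : period_sum N u = 0.
Proof. by have /asboolP[] := displ_valP u. Qed.

(** Up to periodicity, every site lies in the period over which the norm sums. *)
Lemma displ_le_norm u l : `|u l| <= `|u|.
Proof.
have [k ->] := periodic_window l N_gt0 (@displ_periodic u).
rewrite [leRHS]/(displ_norm u) /displ_norm /period_sum (bigD1 k)//= lerDl.
exact: sumr_ge0.
Qed.

Lemma bdiff_periodic u : periodic (bdiff N u) (2 * N)%:Z.
Proof.
by move=> l; rewrite /bdiff displ_periodic -(displ_periodic u (l - 1)) addrAC.
Qed.

Lemma sum_bdiff u : period_sum N (bdiff N u) = 0.
Proof.
pose v l := u (l - 1).
have vP : periodic v (2 * N)%:Z by move=> l; rewrite /v addrAC displ_periodic.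
transitivity (period_sum N (fun l => eps^-1 * v (l + 1) + - eps^-1 * v l)).
  by apply: eq_period_sum => l; rewrite /v /bdiff addrK; ring.
by rewrite period_sumD !period_sumZ (period_sum_shift vP) mulNr subrr.
Qed.

(** The strain carried by the nearest-neighbour ([second = false]) or
    next-nearest-neighbour ([second = true]) interaction at site [l]. *)
Definition bond (second : bool) (l : int) (u : U) : R^o :=
  bdiff N u l + (if second then bdiff N u (l + 1) else 0).

Fact bond_linear b l : linear (bond b l).
Proof.
move=> k u v; rewrite /bond /bdiff.
have E (z : int) : (k *: u + v) z = k * u z + v z by [].
by rewrite !E /GRing.scale/=; case: b; field.
Qed.
HB.instance Definition _ b l := GRing.isLinear.Build R U R^o _ (bond b l)
  (bond_linear b l).

Lemma bond_continuous b l : continuous (bond b l).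
Proof.
have bd m u : `|bdiff N u m| <= 2 / eps * `|u|.
  rewrite /bdiff normrM normfV (gtr0_norm eps_gt0) mulrAC ler_pM2r ?invr_gt0 ?ltr0n//.
  rewrite (le_trans (ler_normB _ _))// mulr_natl mulr2n.
  by rewrite lerD ?displ_le_norm.
apply/linear_bounded_continuous/linear_boundedP; near=> r => u.
apply: (@le_trans _ _ (4 / eps * `|u|)).
  rewrite (le_trans (ler_normD _ _))//.
  have -> : 4 / eps * `|u| = 2 / eps * `|u| + 2 / eps * `|u| by field.
  rewrite lerD ?bd//; case: b; first exact: bd.
  by rewrite normr0 mulr_ge0// divr_ge0// ltW.
rewrite ler_wpM2r//; near: r; apply: nbhs_pinfty_ge.
Unshelve. all: by end_near. Qed.

Definition rest_length (F : R) (second : bool) := if second then 2 * F else F.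

Lemma rest_length_gt0 F b : 0 < F -> 0 < rest_length F b.
Proof. by move=> F0; rewrite /rest_length; case: b; lra. Qed.

Lemma bdiff_yF F u l : bdiff N (fun m => yF N F m + u m) l = F + bdiff N u l.
Proof. by rewrite /bdiff /yF rmorphB/=; field. Qed.

Local Notation node k := ((k : nat)%:Z - N%:Z + 1 : int).

Local Notation bonds := (fun p : bool * 'I_(2 * N) => bond p.1 (node p.2)).
Local Notation rest F := (fun p : bool * 'I_(2 * N) => rest_length F p.1).

Lemma sum_bonds (A : bool -> int -> R) :
  \sum_(p : bool * 'I_(2 * N)) A p.1 (node p.2) =
  period_sum N (A false) + period_sum N (A true).
Proof.
by rewrite -(pair_bigA _ (fun b (k : 'I_(2 * N)) => A b (node k)))/= big_bool addrC.
Qed.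

(** Positivity of all strains is a condition on infinitely many sites, but by
    periodicity finitely many of them matter, so it is open. *)
Lemma atomistic_energy_near (phi : R -> R) (F : R) : 0 < F ->
  \forall u \near (0 : U),
    atomistic_energy N phi (fun l => yF N F l + (u : U) l) =
    (link_energy bonds (rest F) eps phi u)%:E.
Proof.
move=> F0.
have stretched : \forall u \near (0 : U),
    forall k : 'I_(2 * N), 0 < F + bdiff N (u : U) (node k).
  have stretched1 (k : 'I_(2 * N)) :
      \forall u \near (0 : U), 0 < F + bdiff N (u : U) (node k).
    have lim_F : (fun u : U => F + bond false (node k) u) @ (0 : U) --> F.
      rewrite -[X in _ --> X](addr0 F) -(linear0 (bond false (node k))).
      apply: (@cvgD R R^o U (nbhs (0 : U)) _ (cst F)); last exact: bond_continuous.
      exact: cvg_cst.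
    near=> u; have : 0 < F + bond false (node k) u.
      by near: u; exact: (cvgr_gt F lim_F).
    by rewrite /bond addr0.
  exact: (@filter_forall U _ _ (nbhs (0 : U)) _ stretched1).
apply: filterS stretched => u upos.
rewrite /atomistic_energy asboolT => [|l]; last first.
  rewrite bdiff_yF; have [k ->] := periodic_window l N_gt0 (@bdiff_periodic u).
  exact: upos.
congr EFin; rewrite /link_energy.
rewrite (sum_bonds (fun b l => phi (rest_length F b + bond b l u))).
rewrite -period_sumD; congr (_ * _); apply: eq_period_sum => l.
by rewrite !bdiff_yF /bond /= addr0; congr (_ + phi _); ring.
Unshelve. all: by end_near. Qed.

Lemma sum_bond b u : period_sum N (fun l => bond b l u) = 0.
Proof.
rewrite period_sumD sum_bdiff add0r; case: b; last exact: big1.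
by rewrite (period_sum_shift (@bdiff_periodic u)) sum_bdiff.
Qed.

(** The homogeneous deformation is always an equilibrium, because strains sum to
    zero over a period; stability is thus positivity of the only possible second
    variation. *)
Lemma stable_equilibrium_hessian (rstar : R) (phi : R -> R) F :
  interaction_potential rstar phi -> 0 < F ->
  stable_equilibrium N_gt0 F (atomistic_energy N phi) (yF N F) <->
  forall u, u != 0 -> 0 < link_hessian bonds (rest F) eps phi u u.
Proof.
move=> hphi F0; have Lc p : continuous (bonds p) by exact: bond_continuous.
have d1 p : \forall t \near rest F p, derivable phi t 1.
  near=> t; apply: (potential_derivable hphi (k := 0)) => //.
  by near: t; apply: lt_nbhsr; exact: rest_length_gt0.
have d2 p : derivable (phi^`()%classic) (rest F p) 1.
  by apply: (potential_derivable hphi (k := 1)) => //; exact: rest_length_gt0.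
have Enear := atomistic_energy_near phi F0.
pose f : U -> R^o := fun u => fine (atomistic_energy N phi (fun l => yF N F l + u l)).
have fE : {near (0 : U), link_energy bonds (rest F) eps phi =1 f}.
  by near=> u; rewrite /f (near Enear u).
have hess : second_derivative_at f 0 (link_hessian bonds (rest F) eps phi).
  apply: (near_eq_second_derivative fE).
  exact: second_derivative_link_energy.
have diff0 u : 'd f (0 : U) u = 0.
  have [_ ->] := near_eq_is_diff fE
    (nbhs_singleton (is_diff_link_energy eps Lc d1)).
  under eq_bigr do rewrite linear0 addr0.
  rewrite (sum_bonds (fun b l => phi^`()%classic (rest_length F b) * bond b l u)).
  by rewrite !period_sumZ !sum_bond !mulr0 addr0 mulr0.
split=> [[_ _ [B [hessB _ Bpos]]] u u0|pos].
  by rewrite (second_derivative_unique hess hessB) Bpos.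
split.
- by exists 0; apply/funext => l; rewrite addr0.
- by near=> u; rewrite (near Enear u).
- by exists (link_hessian bonds (rest F) eps phi).
Unshelve. all: by end_near. Qed.

(** The square of w_l + w_(l+1) is 2 w_l^2 + 2 w_(l+1)^2 - (w_(l+1) - w_l)^2. *)
Lemma link_hessian_diag (phi : R -> R) F u :
  link_hessian bonds (rest F) eps phi u u =
  eps * (A_F phi F * period_sum N (fun l => bdiff N u l ^+ 2) -
    derive1n 2 phi (2 * F) *
      period_sum N (fun l => (bdiff N u (l + 1) - bdiff N u l) ^+ 2)).
Proof.
rewrite /link_hessian; congr (_ * _).
rewrite (sum_bonds (fun b l => derive1n 2 phi (rest_length F b) *
  (bond b l u * bond b l u))) !period_sumZ /A_F /rest_length.
have sqP : periodic (fun l => bdiff N u l ^+ 2) (2 * N)%:Z.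
  by move=> l; rewrite bdiff_periodic.
have -> : period_sum N (fun l => bond true l u * bond true l u) =
  4 * period_sum N (fun l => bdiff N u l ^+ 2) -
  period_sum N (fun l => (bdiff N u (l + 1) - bdiff N u l) ^+ 2).
  transitivity (period_sum N (fun l => 2 * bdiff N u l ^+ 2 +
     (2 * bdiff N u (l + 1) ^+ 2 + -1 * (bdiff N u (l + 1) - bdiff N u l) ^+ 2))).
    by apply: eq_period_sum => l; rewrite /bond; ring.
  by rewrite !period_sumD !period_sumZ (period_sum_shift sqP); ring.
have -> : period_sum N (fun l => bond false l u * bond false l u) =
  period_sum N (fun l => bdiff N u l ^+ 2).
  by apply: eq_period_sum => l; rewrite /bond addr0.
by ring.
Qed.

(** Half-angle formula: both sides are 4 sin^2 (pi / (2 N)). *)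
Lemma mu_cos : eps ^+ 2 * mu R N ^+ 2 = 2 - 2 * cos (pi / N%:R) :> R.
Proof.
rewrite -exprMn /mu mulrCA mulfV// mulr1.
have half : pi / N%:R = (pi * eps / 2) *+ 2 :> R by rewrite -mulr_natl /spacing; field; rewrite pnatr_eq0 -lt0n.
by rewrite [in RHS]half exprMn sin2cos2 cos_mulr2n -mulr_natl; ring.
Qed.

Lemma mu_gt0 : 0 < eps ^+ 2 * mu R N ^+ 2.
Proof.
rewrite mulr_gt0 ?exprn_gt0// /mu divr_gt0// mulr_gt0//.
have N1 : eps <= 1 by rewrite invf_le1 ?ltr0n// ler1n.
apply: sin_gt0_pi; rewrite divr_gt0 ?mulr_gt0 ?pi_gt0//= -mulrA.
by rewrite -[ltRHS]mulr1 ltr_pM2l ?pi_gt0//; lra.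
Qed.

(** Wirtinger's inequality for [u] itself, whose mean is zero. *)
Lemma sum_bdiff_sqr_gt0 u :
  u != 0 -> 0 < period_sum N (fun l => bdiff N u l ^+ 2).
Proof.
move=> u0.
have sumu : 0 < period_sum N (fun l => u l ^+ 2).
  rewrite lt_neqAle period_sum_ge0 ?andbT => [|l]; last exact: sqr_ge0.
  apply: contraNN u0; rewrite eq_sym psumr_eq0 => [/allP u0|k _]; last exact: sqr_ge0.
  rewrite -normr_eq0 [X in X == _]/(displ_norm u) /displ_norm.
  apply/eqP/big1 => k _; have /implyP/(_ isT) := u0 k (mem_index_enum _).
  by rewrite sqrf_eq0 => /eqP ->; rewrite normr0.
have := discrete_wirtinger N_gt0 (@displ_periodic u) (displ_sum0 u).
rewrite -mu_cos => /(lt_le_trans (mulr_gt0 mu_gt0 sumu)).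
have shiftP : periodic (fun l => bdiff N u l ^+ 2) (2 * N)%:Z.
  by move=> l; rewrite bdiff_periodic.
rewrite -(period_sum_shift shiftP).
rewrite (eq_period_sum _ (g := fun l => eps ^+ 2 * bdiff N u (l + 1) ^+ 2)).
  by rewrite period_sumZ pmulr_rgt0// exprn_gt0.
by move=> l; rewrite /bdiff addrK; field.
Qed.

(** The lowest nonconstant Fourier mode, extremal in Wirtinger's inequality. *)
Definition cosine_mode : int -> R := fun l => cos (pi / N%:R * l%:~R).

Lemma cosine_mode_rec l :
  cosine_mode (l + 1) + cosine_mode (l - 1) =
  2 * cos (pi / N%:R) * cosine_mode l.
Proof.
by rewrite /cosine_mode rmorphD rmorphB/= mulrDr mulrBr mulr1 cosD cosB; ring.
Qed.

Lemma cosine_mode_periodic : periodic cosine_mode (2 * N)%:Z.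
Proof. by move=> l; have := @periodic_cos R N N_gt0 1 l; rewrite mulr1. Qed.

(** Summing the recurrence over a period gives 2 S = 2 cos (pi / N) S for the sum
    S of the mode, hence S = 0. *)
Lemma cosine_mode_in : cosine_mode \in displ_pred N.
Proof.
apply/asboolP; split; first exact: cosine_mode_periodic.
have backP : periodic (fun l => cosine_mode (l - 1)) (2 * N)%:Z.
  by move=> l; rewrite addrAC cosine_mode_periodic.
have : period_sum N (fun l => cosine_mode (l + 1) + cosine_mode (l - 1)) =
    period_sum N cosine_mode + period_sum N cosine_mode.
  rewrite period_sumD (period_sum_shift cosine_mode_periodic).
  rewrite -(period_sum_shift backP); congr (_ + _).
  by apply: eq_period_sum => l; rewrite addrK.
rewrite (eq_period_sum _ cosine_mode_rec) period_sumZ => /eqP.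
rewrite -subr_eq0 => /eqP sum0; have := mu_gt0; rewrite mu_cos => lam0.
apply/(mulfI (lt0r_neq0 lam0)); rewrite mulr0 -[RHS]oppr0 -sum0.
by ring.
Qed.

Definition cosine_displ : U := Displacement N_gt0 cosine_mode_in.

Lemma cosine_displ_neq0 : cosine_displ != 0.
Proof.
apply/eqP => /(congr1 (fun u : U => u 0)).
rewrite /= /cosine_mode mulr0 cos0 => /eqP.
by rewrite [X in _ == X]/(0 : R) oner_eq0.
Qed.

(** The strain inherits the recurrence w_(l+1) + w_(l-1) = 2 c w_l of the mode,
    c = cos (pi / N).
    Multiplying by w_l and summing gives sum w_(l+1) w_l = c * sum w_l^2, which
    is the cross term of the square on the left. *)
Lemma cosine_mode_eigen :
  period_sum N (fun l => (bdiff N cosine_mode (l + 1) - bdiff N cosine_mode l) ^+ 2)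
  = (2 - 2 * cos (pi / N%:R)) * period_sum N (fun l => bdiff N cosine_mode l ^+ 2).
Proof.
set w := bdiff N cosine_mode; set c := cos (pi / N%:R).
have wP : periodic w (2 * N)%:Z := @bdiff_periodic cosine_displ.
have w_rec l : w (l + 1) + w (l - 1) = 2 * c * w l.
  have h1 := cosine_mode_rec l; have := cosine_mode_rec (l - 1).
  rewrite addrNK -/c => h2; rewrite /w /bdiff addrK.
  have -> : 2 * c * ((cosine_mode l - cosine_mode (l - 1)) / eps) =
    (2 * c * cosine_mode l - 2 * c * cosine_mode (l - 1)) / eps by ring.
  by rewrite -h1 -h2; ring.
pose Q l := w (l + 1) * w l.
have sqP : periodic (fun l => w l ^+ 2) (2 * N)%:Z by move=> l; rewrite wP.
have QP : periodic (fun l => w l * w (l - 1)) (2 * N)%:Z.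
  by move=> l; rewrite wP addrAC wP.
have cross : 2 * period_sum N Q = 2 * c * period_sum N (fun l => w l ^+ 2).
  rewrite -period_sumZ.
  transitivity (period_sum N (fun l => Q l + w l * w (l - 1))).
    rewrite period_sumD -(period_sum_shift QP) -period_sumD.
    by apply: eq_period_sum => l; rewrite /Q addrK; ring.
  rewrite -period_sumZ; apply: eq_period_sum => l.
  by rewrite /Q expr2 mulrA -w_rec; ring.
transitivity (period_sum N (fun l => w (l + 1) ^+ 2 + (w l ^+ 2 + -2 * Q l))).
  by apply: eq_period_sum => l; rewrite /Q; ring.
rewrite !period_sumD period_sumZ (period_sum_shift sqP) mulNr cross.
by ring.
Qed.

End Atomistic.

Theorem proposition2 (R : realType) (N : nat) (N_gt0 : (0 < N)%N)
    (rstar : R) (phi : R -> R) (F : R)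
    (hphi : interaction_potential rstar phi)
    (F_gt0 : 0 < F) (F_ge : rstar / 2 <= F)
    (hF : derive1n 2 phi (2 * F) <= 0) :
  stable_equilibrium N_gt0 F (atomistic_energy N phi) (yF N F) <->
  A_F phi F - spacing R N ^+ 2 * mu R N ^+ 2 * derive1n 2 phi (2 * F) > 0.
Proof.
have eps_gt0 : 0 < spacing R N by rewrite invr_gt0 ltr0n.
apply: (iff_trans (stable_equilibrium_hessian N_gt0 hphi F_gt0)).
split=> [pos|coef_gt0 u u0].
  have := pos _ (cosine_displ_neq0 N_gt0).
  rewrite link_hessian_diag pmulr_rgt0// cosine_mode_eigen// -(mu_cos N_gt0).
  set S := period_sum N _; rewrite [_ * (_ * S)]mulrCA mulrA -mulrBl.
  have S0 : 0 <= S by apply: period_sum_ge0 => l; exact: sqr_ge0.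
  by apply: contraTT; rewrite -!leNgt => coef_le0; exact: mulr_le0_ge0.
rewrite link_hessian_diag pmulr_rgt0//.
have S0 := sum_bdiff_sqr_gt0 u0.
(* S and D are the sums of w_l^2 and of (w_(l+1) - w_l)^2. *)
have := discrete_wirtinger N_gt0 (@bdiff_periodic _ _ N_gt0 u) (sum_bdiff u).
rewrite -(mu_cos N_gt0); move: S0 coef_gt0 hF.
set S := period_sum N _; set D := period_sum N _.
set p := derive1n 2 phi (2 * F); set lam := _ * mu R N ^+ 2 => S0 coef p0 SD.
apply: (lt_le_trans (mulr_gt0 coef S0)).
rewrite mulrBl lerD2l lerN2 [lam * p]mulrC -mulrA.
exact: ler_wnM2l.
Qed.
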